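(* The dg operads $\mathscr L_\infty$ and $\mathscr A_\infty$ are acyclic.
   Context: $\mathbf k$ is a field of characteristic $0$; vector spaces are $\mathbb Z/2$-graded, dg means differential $\mathbb Z/2$-graded. Operads are non-unital: collections $\mathcal O(n)$, $n\ge0$, with $S_n$-actions and partial compositions $\circ_i$ (no $S_n$-actions for non-symmetric operads). Acyclic means that the homology vanishes in every arity. For $f\in\mathcal O(n)$, $f\circ x^{\otimes i}$ denotes inserting $x$ in the first $i$ inputs. $A_\infty$ is the non-symmetric dg operad freely generated by odd $m_n\in A_\infty(n)$, $n\ge1$, with $d(m_n)=\sum_{k=1}^n\sum_{i=1}^km_k\circ_im_{n-k+1}$. $L_\infty$ is the dg operad freely generated by odd $S_n$-invariant $m_n\in L_\infty(n)$, $n\ge1$, with $d(m_n)=\sum_{k=1}^n\sum_{\sigma\in\mathrm{Sh}(n-k+1,k-1)}\sigma(m_k\circ_1m_{n-k+1})$. (The unary operation $m_1$ is included.) $\mathcal O[[x]]=\varprojlim_k\mathcal O[x]/(x^k)$ is the completion at the operadic ideal $(x)$ of the operad $\mathcal O[x]$ obtained by freely adjoining $x$. $\mathscr L_\infty=L_\infty[[x]]$ with $x$ even of arity $0$ and $d(x)=\sum_{n\ge1}\frac1{n!}m_n\circ x^{\otimes n}$; $\mathscr A_\infty=A_\infty[[x]]$ with $x$ even of arity $0$ and $d(x)=\sum_{n\ge1}m_n\circ x^{\otimes n}$; the differential restricts to the given one on $L_\infty$, respectively $A_\infty$. *)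

(* Defs.v *)
From mathcomp Require Import all_boot all_order all_fingroup all_algebra.

Set Implicit Arguments.
Unset Strict Implicit.
Unset Printing Implicit Defensive.

Import GRing.Theory.
Local Open Scope ring_scope.

(* [shom V false] and [shom V true] are the even and the odd part of V. *)
Record superMod (k : fieldType) := SuperMod {
  scar :> lmodType k;
  shom : bool -> scar -> Prop;
  shom_lin : forall p (a : k) (u v : scar),
    shom p u -> shom p v -> shom p (a *: u + v);
  shom_split : forall u : scar,
    exists v w, [/\ shom false v, shom true w & u = v + w];
  shom_disj : forall u : scar, shom false u -> shom true u -> u = 0
}.

(* Slots are numbered from 0.  Given f with slots 0, 1, ... and g of arity m,
   [slot m i j] is the position in f o_i g of the slot j != i of f. *)
Definition slot (m i j : nat) : nat := if (j < i)%N then j else (j + m).-1.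

(* u is the permutation s o_i t of the slots of f o_i g that is induced by
   permutations s of the slots of f and t of the slots of g. *)
Definition block_perm (l m r : nat) (i : 'I_l) (s : 'S_l) (t : 'S_m)
    (u : 'S_r) : Prop :=
  (forall (j : 'I_m) (a : 'I_r), a = (i + j)%N :> nat ->
     u a = (s i + t j)%N :> nat) /\
  (forall (j : 'I_l) (a : 'I_r), j != i -> a = slot m i j :> nat ->
     u a = slot m (s i) (s j) :> nat).

(* Non-unital graded operads: symmetric ones for [b = true], non-symmetric ones
   for [b = false] (then [oact] has an empty domain and carries no data).
   The arity r of f o_i g is a parameter constrained by r + 1 = l + m, so that
   the axioms need no transport along equalities of arities.
   The action relabels slots, sending slot a to slot s a; it is a left action
   for the composition s \o t of permutations, which MathComp writes t * s. *)
Record operad (k : fieldType) (b : bool) := Operad {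
  ocar :> nat -> superMod k;
  ocomp : forall (l m r : nat) (i : 'I_l), r.+1 = (l + m)%N ->
    ocar l -> ocar m -> ocar r;
  ocomp_linl : forall (l m r : nat) (i : 'I_l) (e : r.+1 = (l + m)%N)
    (a : k) (f f' : ocar l) (g : ocar m),
    ocomp i e (a *: f + f') g = a *: ocomp i e f g + ocomp i e f' g;
  ocomp_linr : forall (l m r : nat) (i : 'I_l) (e : r.+1 = (l + m)%N)
    (a : k) (f : ocar l) (g g' : ocar m),
    ocomp i e f (a *: g + g') = a *: ocomp i e f g + ocomp i e f g';
  ocomp_hom : forall (l m r : nat) (i : 'I_l) (e : r.+1 = (l + m)%N)
    (p q : bool) (f : ocar l) (g : ocar m),
    shom p f -> shom q g -> shom (p (+) q) (ocomp i e f g);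
  ocomp_seq : forall (l m n r s t : nat) (i : 'I_l) (j : 'I_m) (ij : 'I_r)
    (e1 : r.+1 = (l + m)%N) (e2 : t.+1 = (r + n)%N)
    (e3 : s.+1 = (m + n)%N) (e4 : t.+1 = (l + s)%N)
    (f : ocar l) (g : ocar m) (h : ocar n),
    ij = (i + j)%N :> nat ->
    ocomp ij e2 (ocomp i e1 f g) h = ocomp i e4 f (ocomp j e3 g h);
  ocomp_par : forall (l m n r s t : nat) (i j : 'I_l) (j' : 'I_r) (i' : 'I_s)
    (e1 : r.+1 = (l + m)%N) (e2 : t.+1 = (r + n)%N)
    (e3 : s.+1 = (l + n)%N) (e4 : t.+1 = (s + m)%N)
    (p q : bool) (f : ocar l) (g : ocar m) (h : ocar n),
    (i < j)%N -> j' = slot m i j :> nat -> i' = slot n j i :> nat ->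
    shom p g -> shom q h ->
    ocomp j' e2 (ocomp i e1 f g) h
      = (-1) ^+ (p && q) *: ocomp i' e4 (ocomp j e3 f h) g;
  oact : b -> forall n, 'S_n -> ocar n -> ocar n;
  oact_lin : forall (hb : b) n (s : 'S_n) (a : k) (f g : ocar n),
    oact hb s (a *: f + g) = a *: oact hb s f + oact hb s g;
  oact_hom : forall (hb : b) n (s : 'S_n) p (f : ocar n),
    shom p f -> shom p (oact hb s f);
  oact1 : forall (hb : b) n (f : ocar n), oact hb 1%g f = f;
  oactM : forall (hb : b) n (s t : 'S_n) (f : ocar n),
    oact hb (t * s)%g f = oact hb s (oact hb t f);
  oact_comp : forall (hb : b) (l m r : nat) (i : 'I_l) (e : r.+1 = (l + m)%N)
    (s : 'S_l) (t : 'S_m) (u : 'S_r) (f : ocar l) (g : ocar m),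
    block_perm i s t u ->
    ocomp (s i) e (oact hb s f) (oact hb t g) = oact hb u (ocomp i e f g)
}.

Record dgOperad (k : fieldType) (b : bool) := DgOperad {
  dg_operad :> operad k b;
  diff : forall n, dg_operad n -> dg_operad n;
  diff_lin : forall n (a : k) (f g : dg_operad n),
    diff (a *: f + g) = a *: diff f + diff g;
  diff_odd : forall n p (f : dg_operad n), shom p f -> shom (~~ p) (diff f);
  diff_sq : forall n (f : dg_operad n), diff (diff f) = 0;
  diff_act : forall (hb : b) n (s : 'S_n) (f : dg_operad n),
    diff (oact hb s f) = oact hb s (diff f);
  diff_comp : forall (l m r : nat) (i : 'I_l) (e : r.+1 = (l + m)%N) (p : bool)
    (f : dg_operad l) (g : dg_operad m), shom p f ->
    diff (ocomp i e f g)
      = ocomp i e (diff f) g + (-1) ^+ p *: ocomp i e f (diff g)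
}.

Definition acyclic (k : fieldType) (b : bool) (P : dgOperad k b) : Prop :=
  forall n (f : P n), diff f = 0 -> exists g : P n, diff g = f.

Section Constructions.
Context {k : fieldType} {b : bool}.
Implicit Types P Q : operad k b.

Record morphism P Q (phi : forall n, P n -> Q n) : Prop := Morphism {
  mor_lin : forall n (a : k) (f g : P n),
    phi n (a *: f + g) = a *: phi n f + phi n g;
  mor_hom : forall n p (f : P n), shom p f -> shom p (phi n f);
  mor_comp : forall (l m r : nat) (i : 'I_l) (e : r.+1 = (l + m)%N)
    (f : P l) (g : P m),
    phi r (ocomp i e f g) = ocomp i e (phi l f) (phi m g);
  mor_act : forall (hb : b) n (s : 'S_n) (f : P n),
    phi n (oact hb s f) = oact hb s (phi n f)
}.

Definition exists_unique_morphism P Q (T : (forall n, P n -> Q n) -> Prop) :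
    Prop :=
  (exists phi, morphism phi /\ T phi) /\
  (forall phi psi, morphism phi -> T phi -> morphism psi -> T psi ->
     forall n (f : P n), phi n f = psi n f).

(* Here and below a family m only matters in arities n >= 1; the value m 0 is
   never used. *)
Definition odd_invariant P (m : forall n, P n) : Prop :=
  forall n, (0 < n)%N ->
    shom true (m n) /\ (forall (hb : b) (s : 'S_n), oact hb s (m n) = m n).

Definition freely_generated P (m : forall n, P n) : Prop :=
  odd_invariant m /\
  forall Q (q : forall n, Q n), odd_invariant q ->
    exists_unique_morphism (fun phi : forall n, P n -> Q n =>
      forall n, (0 < n)%N -> phi n (m n) = q n).

(* Q = P[x], with iota : P -> P[x]. *)
Definition freely_adjoins P Q (iota : forall n, P n -> Q n) (x : Q 0) : Prop :=
  [/\ morphism iota, shom false x &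
  forall (R : operad k b) (phi : forall n, P n -> R n) (y : R 0),
    morphism phi -> shom false y ->
    exists_unique_morphism (fun psi : forall n, Q n -> R n =>
      (forall n (f : P n), psi n (iota n f) = phi n f) /\ psi 0 x = y)].

Record ideal P (I : forall n, P n -> Prop) : Prop := Ideal {
  ideal0 : forall n, I n 0;
  ideal_lin : forall n (a : k) (f g : P n), I n f -> I n g -> I n (a *: f + g);
  ideal_compl : forall (l m r : nat) (i : 'I_l) (e : r.+1 = (l + m)%N)
    (f : P l) (g : P m), I l f -> I r (ocomp i e f g);
  ideal_compr : forall (l m r : nat) (i : 'I_l) (e : r.+1 = (l + m)%N)
    (f : P l) (g : P m), I m g -> I r (ocomp i e f g);
  ideal_act : forall (hb : b) n (s : 'S_n) (f : P n), I n f -> I n (oact hb s f)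
}.

Definition ideal_gen P (x : P 0) : forall n, P n -> Prop :=
  fun n f => forall I : forall n, P n -> Prop, ideal I -> I 0 x -> I n f.

Record filtration P (J : nat -> forall n, P n -> Prop) : Prop := Filtration {
  filt0 : forall n (f : P n), J 0 n f;
  filt_zero : forall c n, J c n 0;
  filt_lin : forall c n (a : k) (f g : P n),
    J c n f -> J c n g -> J c n (a *: f + g);
  filt_comp : forall c c' (l m r : nat) (i : 'I_l) (e : r.+1 = (l + m)%N)
    (f : P l) (g : P m), J c l f -> J c' m g -> J (c + c')%N r (ocomp i e f g);
  filt_act : forall (hb : b) c n (s : 'S_n) (f : P n),
    J c n f -> J c n (oact hb s f)
}.

(* The c-th power of I, spanned by the iterated composites involving at least
   c elements of I: the smallest multiplicative filtration with I in step 1. *)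
Definition ideal_pow P (I : forall n, P n -> Prop) :
    nat -> forall n, P n -> Prop :=
  fun c n f => forall J : nat -> forall n, P n -> Prop, filtration J ->
    (forall n (g : P n), I n g -> J 1 n g) -> J c n f.

(* C is the limit of the quotient operads P / J c. *)
Record completion P (J : nat -> forall n, P n -> Prop) (C : operad k b) :=
    Completion {
  cquo : nat -> operad k b;
  cpi : forall c n, P n -> cquo c n;
  cpi_mor : forall c, morphism (cpi c);
  cpi_surj : forall c n (u : cquo c n), exists f : P n, cpi c f = u;
  cpi_ker : forall c n (f : P n), cpi c f = 0 <-> J c n f;
  ctrans : forall c n, cquo c.+1 n -> cquo c n;
  ctrans_mor : forall c, morphism (@ctrans c);
  ctrans_pi : forall c n (f : P n), ctrans (cpi c.+1 f) = cpi c f;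
  cproj : forall c n, C n -> cquo c n;
  cproj_mor : forall c, morphism (cproj c);
  cproj_trans : forall c n (z : C n), ctrans (cproj c.+1 z) = cproj c z;
  cproj_inj : forall n (z z' : C n),
    (forall c, cproj c z = cproj c z') -> z = z';
  cproj_lift : forall n (u : forall c, cquo c n),
    (forall c, ctrans (u c.+1) = u c) ->
    exists z : C n, forall c, cproj c z = u c;
  ccan : forall n, P n -> C n;
  ccan_proj : forall c n (f : P n), cproj c (ccan f) = cpi c f
}.

(* z is the sum of the series u 1 + u 2 + ... *)
Definition has_sum P J C (K : @completion P J C) n (u : nat -> C n) (z : C n) :
    Prop :=
  forall c, exists N, forall M, (N <= M)%N ->
    cproj K c (\sum_(1 <= a < M.+1) u a) = cproj K c z.

(* f o x^{(x) n}, for f of arity n *)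
Fixpoint plug P (x : P 0) (n : nat) : P n -> P 0 :=
  match n return P n -> P 0 with
  | 0 => fun f => f
  | n'.+1 => fun f => plug x (ocomp (r := n') ord0 (esym (addn0 n'.+1)) f x)
  end.

(* C = O[[x]] as an operad, with a continuous differential extending that
   of O; the value of the differential on x is left open. *)
Record series_ext (O C : dgOperad k b) := SeriesExt {
  se_poly : operad k b;
  se_iota : forall n, O n -> se_poly n;
  se_x : se_poly 0;
  se_adjoin : freely_adjoins se_iota se_x;
  se_compl : completion (ideal_pow (ideal_gen se_x)) C;
  se_diff : forall n (f : O n),
    diff (ccan se_compl (se_iota f)) = ccan se_compl (se_iota (diff f));
  se_cont : forall c n, exists c', forall z : C n,
    cproj se_compl c' z = 0 -> cproj se_compl c (diff z) = 0
}.

End Constructions.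

Lemma gen_arity n (c : 'I_n) : n.+1 = (c.+1 + (n - c))%N.
Proof. by rewrite addSn subnKC // ltnW. Qed.

(* In the differentials the summation index c stands for k - 1. *)
Definition is_Ainf (k : fieldType) (O : dgOperad k false) (m : forall n, O n) :
    Prop :=
  freely_generated m /\
  forall n, (0 < n)%N ->
    diff (m n) = \sum_(c < n) \sum_(i < c.+1)
                   ocomp i (gen_arity c) (m c.+1) (m (n - c)%N).

(* s is a (p, n - p)-shuffle. *)
Definition shuffle (p n : nat) (s : 'S_n) : bool :=
  [forall i : 'I_n, forall j : 'I_n,
    [&& (i < j)%N & (j < p)%N || (p <= i)%N] ==> (s i < s j)%N].

Definition is_Linf (k : fieldType) (O : dgOperad k true) (m : forall n, O n) :
    Prop :=
  freely_generated m /\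
  forall n, (0 < n)%N ->
    diff (m n) = \sum_(c < n) \sum_(s : 'S_n | shuffle (n - c)%N s)
                   oact isT s (ocomp ord0 (gen_arity c) (m c.+1) (m (n - c)%N)).

Definition is_scrAinf (k : fieldType) (C : dgOperad k false) : Prop :=
  exists (O : dgOperad k false) (m : forall n, O n) (E : series_ext O C),
    is_Ainf m /\
    has_sum (se_compl E)
      (fun n => ccan (se_compl E) (plug (se_x E) (se_iota E (m n))))
      (diff (ccan (se_compl E) (se_x E))).

Definition is_scrLinf (k : fieldType) (C : dgOperad k true) : Prop :=
  exists (O : dgOperad k true) (m : forall n, O n) (E : series_ext O C),
    is_Linf m /\
    has_sum (se_compl E)
      (fun n => (n`!%:R)^-1 *:
                ccan (se_compl E) (plug (se_x E) (se_iota E (m n))))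
      (diff (ccan (se_compl E) (se_x E))).

(* Main.v *)
From mathcomp Require Import all_boot all_order all_fingroup all_algebra.
From Stdlib Require Import ClassicalEpsilon.
Require Import Defs.
Import GRing.Theory.
Local Open Scope ring_scope.

Set Implicit Arguments.
Unset Strict Implicit.
Unset Printing Implicit Defensive.

(** Let h delete the root of a tree when this root is the unary vertex m_1, and
    send every other tree, in particular x, to 0; the tree m_1 itself becomes an
    adjoined identity.  Then h (f o_i g) = h f o_i g, and therefore d h + h d
    is again compatible with right composition, although h is not a derivation.
    It is the identity on the generators, because m_1 o m_n and m_1 o x are the
    only terms of d m_n and d x with a removable root.  So d h + h d = id on
    operadic polynomials, and on the completion by continuity. *)

(** The operads are given by universal properties alone, which produce and compare morphisms,
    whereas h is neither a morphism nor a derivation. Hence h is encoded as a morphism f |-> (f, h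
    f, e f) into an auxiliary operad, where e f is the coefficient of the identity that a non-unital
    operad lacks. The existence clause yields h; the uniqueness clause turns the vanishing of d h +
    h d - id on generators into its vanishing on polynomials. A second obstacle is that d x is an
    infinite series, so that d does not act on polynomials. The defect d h + h d - id is therefore
    formed on the completion and only then restricted to polynomials, which is why right linearity
    is relative to a morphism [j]. The operator h passes to the completion because deleting a unary
    root m_1 deletes no x. *)

Section LinearFunctions.
Context {k : fieldType} {V W : lmodType k} {f : V -> W}.
Hypothesis f_lin : forall (a : k) (u v : V), f (a *: u + v) = a *: f u + f v.

Lemma lin0 : f 0 = 0.
Proof. by have := f_lin (-1) 0 0; rewrite scaler0 addr0 scaleN1r addNr. Qed.

Lemma linD u v : f (u + v) = f u + f v.
Proof. by have := f_lin 1 u v; rewrite !scale1r. Qed.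

Lemma linZ a u : f (a *: u) = a *: f u.
Proof. by have := f_lin a u 0; rewrite lin0 !addr0. Qed.

Lemma linB u v : f (u - v) = f u - f v.
Proof. by rewrite -!scaleN1r linD linZ. Qed.

Lemma lin_sum I (r : seq I) (p : pred I) (F : I -> V) :
  f (\sum_(i <- r | p i) F i) = \sum_(i <- r | p i) f (F i).
Proof. exact: (big_morph f linD lin0). Qed.

End LinearFunctions.

(** * Graded modules and casts between arities *)

Section Super.
Context {k : fieldType}.

Lemma shom0 (V : superMod k) p : shom p (0 : V).
Proof.
have [v [w [hv hw _]]] := shom_split (0 : V).
case: p; first by have := shom_lin (-1) hw hw; rewrite scaleN1r addNr.
by have := shom_lin (-1) hv hv; rewrite scaleN1r addNr.
Qed.

Lemma shomD (V : superMod k) p (u v : V) :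
  shom p u -> shom p v -> shom p (u + v).
Proof. by move=> hu hv; have := shom_lin 1 hu hv; rewrite scale1r. Qed.

Lemma shomZ (V : superMod k) p a (u : V) : shom p u -> shom p (a *: u).
Proof. by move=> hu; have := shom_lin a hu (shom0 V p); rewrite addr0. Qed.

Section ExtMod.
Context (s : bool) (V : superMod k).

Definition ext_car : lmodType k := (V * V * k^o)%type.

(** An operator of parity [s] shifts the second entry by [s]; the adjoined identity is even, so its
    coefficient may be nonzero only for p = s. *)
Definition ext_hom (p : bool) (u : ext_car) : Prop :=
  [/\ shom p u.1.1, shom (p (+) s) u.1.2 & p = s \/ u.2 = 0].

Lemma ext_hom_lin p (a : k) (u v : ext_car) :
  ext_hom p u -> ext_hom p v -> ext_hom p (a *: u + v).
Proof.
case=> hu1 hu2 hu3 [hv1 hv2 hv3]; split; [exact: shom_lin | exact: shom_lin |].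
case: hu3 => [|hu3]; first by left.
case: hv3 => [|hv3]; first by left.
by right; rewrite /= hu3 hv3 scaler0 addr0.
Qed.

Lemma ext_hom_split (u : ext_car) :
  exists v w, [/\ ext_hom false v, ext_hom true w & u = v + w].
Proof.
case: u => [[f a] l].
have [f0 [f1 [hf0 hf1 ->]]] := shom_split f.
have [a0 [a1 [ha0 ha1 ->]]] := shom_split a.
rewrite /ext_hom; case: s.
  exists (f0, a1, 0), (f1, a0, l); split; [by split=> //; right | by split=> //; left |].
  by congr (_, _, _); rewrite /= ?add0r // addrC.
exists (f0, a0, l), (f1, a1, 0); split; [by split=> //; left | by split=> //; right |].
by congr (_, _, _); rewrite /= ?addr0.
Qed.

Lemma ext_hom_disj (u : ext_car) : ext_hom false u -> ext_hom true u -> u = 0.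
Proof.
case: u => [[f a] l] [/= h1 h2 h3] [/= h4 h5 h6].
rewrite (shom_disj h1 h4).
have -> : a = 0.
  case: (s) h2 h5 => h2 h5; first exact: (shom_disj h5 h2).
  exact: (shom_disj h2 h5).
by case: h3 h6 => [<-|->] // [] // ->.
Qed.

Definition ext_mod : superMod k :=
  SuperMod ext_hom_lin ext_hom_split ext_hom_disj.

End ExtMod.

Section Transfer.
Context (V : nat -> superMod k).

(** The composite of the adjoined identity with [v]. Being total, with value 0 when the arities
    differ, it needs no proof of m = r, and it makes an identity coefficient outside arity 1 act by
    zero. *)
Definition transfer m r (v : V m) : V r :=
  if @eqP _ m r is ReflectT e then ecast n (V n) e v else 0.

Lemma transfer_id m (v : V m) : transfer m v = v.
Proof. by rewrite /transfer; case: eqP => // e; rewrite (eq_irrelevance e erefl). Qed.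

Lemma transfer_neq m r (v : V m) : m <> r -> transfer r v = 0.
Proof. by rewrite /transfer; case: eqP. Qed.

Lemma transfer_lin m r (a : k) (u v : V m) :
  transfer r (a *: u + v) = a *: transfer r u + transfer r v.
Proof.
have [<-|/eqP ne] := eqVneq m r; first by rewrite !transfer_id.
by rewrite !transfer_neq // scaler0 addr0.
Qed.

Lemma transfer_hom m r p (u : V m) : shom p u -> shom p (transfer r u).
Proof.
have [<-|/eqP ne] := eqVneq m r; first by rewrite transfer_id.
by rewrite transfer_neq // => _; exact: shom0.
Qed.

End Transfer.

Lemma transfer_map (V W : nat -> superMod k) (f : forall n, V n -> W n) m r
    (v : V m) :
  (forall n, f n 0 = 0) -> f r (transfer r v) = transfer r (f m v).
Proof.
move=> f0; have [<-|/eqP ne] := eqVneq m r; first by rewrite !transfer_id.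
by rewrite !transfer_neq.
Qed.

End Super.

Arguments transfer {k V m} r v.

Section OperadFacts.
Context {k : fieldType} {b : bool}.
Implicit Types P Q R : operad k b.

Lemma ocomp0l P l m r (i : 'I_l) (e : r.+1 = (l + m)%N) (g : P m) :
  ocomp i e (0 : P l) g = 0.
Proof. by have := ocomp_linl i e (-1) 0 0 g; rewrite scaler0 addr0 scaleN1r addNr. Qed.

Lemma ocompZl P l m r (i : 'I_l) (e : r.+1 = (l + m)%N) a (f : P l) (g : P m) :
  ocomp i e (a *: f) g = a *: ocomp i e f g.
Proof. by have := ocomp_linl i e a f 0 g; rewrite ocomp0l !addr0. Qed.

Lemma ocompDl P l m r (i : 'I_l) (e : r.+1 = (l + m)%N) (f f' : P l) (g : P m) :
  ocomp i e (f + f') g = ocomp i e f g + ocomp i e f' g.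
Proof. by have := ocomp_linl i e 1 f f' g; rewrite !scale1r. Qed.

Lemma ocompBl P l m r (i : 'I_l) (e : r.+1 = (l + m)%N) (f f' : P l) (g : P m) :
  ocomp i e (f - f') g = ocomp i e f g - ocomp i e f' g.
Proof. by rewrite -!scaleN1r ocompDl ocompZl. Qed.

Lemma oact0 P (hb : b) n (s : 'S_n) : oact hb s (0 : P n) = 0 :> P n.
Proof. exact: lin0 (oact_lin hb s). Qed.

Lemma morphism_id P : morphism (fun n (f : P n) => f).
Proof. by split. Qed.

Lemma morphism_comp P Q R (phi : forall n, P n -> Q n)
    (psi : forall n, Q n -> R n) :
  morphism phi -> morphism psi -> morphism (fun n f => psi n (phi n f)).
Proof.
move=> [l1 h1 c1 a1] [l2 h2 c2 a2]; split=> *.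
- by rewrite l1 l2.
- by apply: h2; apply: h1.
- by rewrite c1 c2.
- by rewrite a1 a2.
Qed.

Lemma morphism_odd_invariant P Q (phi : forall n, P n -> Q n)
    (m : forall n, P n) :
  morphism phi -> odd_invariant m -> odd_invariant (fun n => phi n (m n)).
Proof.
move=> [_ h _ a] om n n0; have [o i] := om n n0.
by split=> [|hb s]; [exact: h | rewrite -a i].
Qed.

Lemma block_perm1 m (i : 'I_1) (s : 'S_1) (t u : 'S_m) :
  block_perm i s t u -> u = t.
Proof.
case=> ht _; apply/permP=> j; apply: val_inj.
by rewrite /= (ht j j) ?ord1.
Qed.

(** * The operad of operator values with an adjoined identity *)

Section Extension.
Context (s : bool) (P : operad k b).

Let X n := ext_mod s (P n).

(** The operator stands to the left of both factors and only acts on the left one, so even an odd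
    operator causes no Koszul sign. The last entry is 0, since (a + c id) o_i g = a o_i g + c g has
    no identity term. *)
Definition ext_comp (l m r : nat) (i : 'I_l) (e : r.+1 = (l + m)%N)
    (u : X l) (v : X m) : X r :=
  (ocomp i e u.1.1 v.1.1, ocomp i e u.1.2 v.1.1 + u.2 *: transfer r v.1.1, 0).

Definition ext_act (hb : b) n (t : 'S_n) (u : X n) : X n :=
  (oact hb t u.1.1, oact hb t u.1.2, u.2).

Lemma ext_comp_linl (l m r : nat) (i : 'I_l) (e : r.+1 = (l + m)%N)
    (a : k) (f f' : X l) (g : X m) :
  ext_comp i e (a *: f + f') g = a *: ext_comp i e f g + ext_comp i e f' g.
Proof.
congr (_, _, _) => /=; rewrite ?scaler0 ?addr0 ?ocomp_linl //.
by rewrite scalerDl scalerDr scalerA -!addrA; congr (_ + _); rewrite addrCA.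
Qed.

Lemma ext_comp_linr (l m r : nat) (i : 'I_l) (e : r.+1 = (l + m)%N)
    (a : k) (f : X l) (g g' : X m) :
  ext_comp i e f (a *: g + g') = a *: ext_comp i e f g + ext_comp i e f g'.
Proof.
congr (_, _, _) => /=; rewrite ?scaler0 ?addr0 ?ocomp_linr //.
rewrite transfer_lin !scalerDr !scalerA (mulrC a) -!addrA; congr (_ + _).
by rewrite addrCA.
Qed.

Lemma ext_comp_hom (l m r : nat) (i : 'I_l) (e : r.+1 = (l + m)%N)
    (p q : bool) (f : X l) (g : X m) :
  shom p f -> shom q g -> shom (p (+) q) (ext_comp i e f g).
Proof.
move=> [h1 h2 h3] [h4 _ _]; split; [exact: ocomp_hom | | by right].
apply: shomD; first by rewrite addbAC; exact: ocomp_hom.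
case: h3 => [->|->]; last by rewrite scale0r; exact: shom0.
by rewrite addbC addbA addbb; apply: shomZ; exact: transfer_hom.
Qed.

Lemma ext_comp_seq (l m n r s' t : nat) (i : 'I_l) (j : 'I_m) (ij : 'I_r)
    (e1 : r.+1 = (l + m)%N) (e2 : t.+1 = (r + n)%N)
    (e3 : s'.+1 = (m + n)%N) (e4 : t.+1 = (l + s')%N)
    (f : X l) (g : X m) (h : X n) :
  ij = (i + j)%N :> nat ->
  ext_comp ij e2 (ext_comp i e1 f g) h = ext_comp i e4 f (ext_comp j e3 g h).
Proof.
move=> hij; congr (_, _, _) => /=; first exact: ocomp_seq.
rewrite scale0r addr0 ocompDl ocompZl.
congr (_ + _ *: _); first exact: ocomp_seq.
(* The identity terms survive only if the left factor is unary; then r = m and t = s', and both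
   transfers are trivial. *)
have [l1|/eqP l1] := eqVneq l 1%N; last first.
  rewrite !transfer_neq ?ocomp0l //.
    by move=> est; apply: l1; move/eqP: e4; rewrite est -add1n eqn_add2r => /eqP.
  by move=> est; apply: l1; move/eqP: e1; rewrite est -add1n eqn_add2r => /eqP.
subst l; case: (e1) => e1'; case: (e4) => e4'; subst r t.
rewrite !transfer_id (eq_irrelevance e2 e3); congr ocomp.
by apply: val_inj; rewrite /= hij ord1.
Qed.

Lemma ext_comp_par (l m n r s' t : nat) (i j : 'I_l) (j' : 'I_r) (i' : 'I_s')
    (e1 : r.+1 = (l + m)%N) (e2 : t.+1 = (r + n)%N)
    (e3 : s'.+1 = (l + n)%N) (e4 : t.+1 = (s' + m)%N)
    (p q : bool) (f : X l) (g : X m) (h : X n) :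
  (i < j)%N -> j' = slot m i j :> nat -> i' = slot n j i :> nat ->
  shom p g -> shom q h ->
  ext_comp j' e2 (ext_comp i e1 f g) h
    = (-1) ^+ (p && q) *: ext_comp i' e4 (ext_comp j e3 f h) g.
Proof.
move=> ij hj hi [hg _ _] [hh _ _].
(* Two distinct slots exclude l = 1, so every transfer vanishes. *)
have l1 : l <> 1%N.
  by move=> l1; move: (ltn_ord j) ij; rewrite [X in (_ < X)%N]l1 ltnS leqn0 => /eqP ->.
congr (_, _, _); rewrite /= ?scaler0 //; first exact: (ocomp_par e1 e2 e3 e4 _ ij).
rewrite !scale0r !addr0 !transfer_neq ?scaler0 ?addr0.
- exact: (ocomp_par e1 e2 e3 e4 _ ij).
- by move=> est; apply: l1; move/eqP: e3; rewrite est -add1n eqn_add2r => /eqP.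
- by move=> est; apply: l1; move/eqP: e1; rewrite est -add1n eqn_add2r => /eqP.
Qed.

Lemma ext_act_comp (hb : b) (l m r : nat) (i : 'I_l) (e : r.+1 = (l + m)%N)
    (t : 'S_l) (t' : 'S_m) (u : 'S_r) (f : X l) (g : X m) :
  block_perm i t t' u ->
  ext_comp (t i) e (ext_act hb t f) (ext_act hb t' g)
    = ext_act hb u (ext_comp i e f g).
Proof.
move=> hu; congr (_, _, _) => /=; first exact: oact_comp.
rewrite (linD (oact_lin hb u)) (linZ (oact_lin hb u)).
congr (_ + _ *: _); first exact: oact_comp.
have [l1|/eqP l1] := eqVneq l 1%N.
  subst l; case: (e) => e'; subst r.
  by rewrite !transfer_id (block_perm1 hu).
have ne : m <> r.
  by move=> est; apply: l1; move/eqP: e; rewrite -est -add1n eqn_add2r => /eqP.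
by rewrite !transfer_neq // oact0.
Qed.

(* An element (f, a, c) stands for f together with a value a + c id of an
   operator at f, where id is an adjoined identity.  The composition is made so
   that the operators h with h (f o_i g) = h f o_i g are those for which
   f |-> (f, h f) is a morphism of operads; s is the parity of h.  The entry c
   only has this meaning in arity 1: a nonzero c in another arity is junk that
   acts by zero. *)
Definition ext_operad : operad k b.
Proof.
apply: (@Operad k b X ext_comp ext_comp_linl ext_comp_linr ext_comp_hom
          ext_comp_seq ext_comp_par ext_act); last exact: ext_act_comp.
- by move=> hb n t a f g; congr (_, _, _); exact: oact_lin.
- by move=> hb n t p f [h1 h2 h3]; split=> //; exact: oact_hom.
- by move=> hb n [[f a] l]; congr (_, _, _); exact: oact1.
- by move=> hb n t t' f; congr (_, _, _); exact: oactM.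
Defined.

End Extension.
End OperadFacts.

(** * Right linear operators as morphisms, determined by generators *)

Section RightLinear.
Context {k : fieldType} {b : bool}.
Implicit Types P Q R : operad k b.

Lemma eq_morphism P Q (phi psi : forall n, P n -> Q n) :
  morphism phi -> (forall n (f : P n), phi n f = psi n f) -> morphism psi.
Proof.
move=> [p1 p2 p3 p4] E; split.
- by move=> n a f g; rewrite -!E p1.
- by move=> n p f hf; rewrite -E; exact: p2.
- by move=> l m r i e f g; rewrite -!E p3.
- by move=> hb n t f; rewrite -!E p4.
Qed.

(** The universal properties of O and O[x] merged into one, so that operators on polynomials can be
    prescribed on the m_n and on x at once. *)
Definition generated_by P (g : forall n, P n) (x : P 0) : Prop :=
  [/\ odd_invariant g, shom false x &
  forall Q (q : forall n, Q n) (y : Q 0), odd_invariant q -> shom false y ->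
    exists_unique_morphism (fun phi : forall n, P n -> Q n =>
      (forall n, (0 < n)%N -> phi n (g n) = q n) /\ phi 0 x = y)].

Lemma adjoin_generated_by P Q (m : forall n, P n) (iota : forall n, P n -> Q n)
    (x : Q 0) :
  freely_generated m -> freely_adjoins iota x ->
  generated_by (fun n => iota n (m n)) x.
Proof.
move=> [om um] [mi ex ux]; split=> // [|R q y oq ey].
  exact: morphism_odd_invariant.
have [[phi [mphi phiE]] uphi] := um R q oq; split.
  have [[psi [mpsi [psi1 psi2]]] _] := ux R phi y mphi ey.
  by exists psi; split=> //; split=> // n n0; rewrite psi1 phiE.
move=> psi psi' mpsi [psi1 psi2] mpsi' [psi1' psi2'].
have [_ upsi] := ux R phi y mphi ey.
have comp_iota theta : morphism theta ->
    (forall n, (0 < n)%N -> theta n (iota n (m n)) = q n) ->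
    forall n (f : P n), theta n (iota n f) = phi n f.
  move=> mtheta thetaE n f.
  exact: (uphi _ _ (morphism_comp mi mtheta) thetaE mphi phiE).
by apply: upsi => //; split=> //; exact: comp_iota.
Qed.

(** The single word morphism packs linearity, parity, equivariance and the rule h (f o_i g) = h f
    o_i j g + e f j g, and makes universal properties applicable to [h]. *)
Definition right_linear P Q (s : bool) (j h : forall n, P n -> Q n)
    (e : forall n, P n -> k) : Prop :=
  morphism (Q := ext_operad s Q) (fun n f => (j n f, h n f, e n f)).

Section Theory.
Context {P Q : operad k b} {s : bool} {j h : forall n, P n -> Q n}.
Context {e : forall n, P n -> k} (rh : right_linear s j h e).

Lemma right_linear_lin n (a : k) (u v : P n) :
  h (a *: u + v) = a *: h u + h v.
Proof. exact: (congr1 (fun w => w.1.2) (mor_lin rh a u v)). Qed.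

Lemma right_linear_elin n (a : k) (u v : P n) :
  e (a *: u + v) = a * e u + e v.
Proof. exact: (congr1 snd (mor_lin rh a u v)). Qed.

Lemma right_linearD n (u v : P n) : h (u + v) = h u + h v.
Proof. exact: (linD (right_linear_lin (n := n))). Qed.

Lemma right_linearZ n a (u : P n) : h (a *: u) = a *: h u.
Proof. exact: (linZ (right_linear_lin (n := n))). Qed.

Lemma right_linear_eD n (u v : P n) : e (u + v) = e u + e v.
Proof. exact: (@linD _ _ k^o _ (right_linear_elin (n := n))). Qed.

Lemma right_linear_eZ n a (u : P n) : e (a *: u) = a * e u.
Proof. exact: (@linZ _ _ k^o _ (right_linear_elin (n := n))). Qed.

Lemma right_linear_sum n I (r : seq I) (p : pred I) (F : I -> P n) :
  h (\sum_(i <- r | p i) F i) = \sum_(i <- r | p i) h (F i).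
Proof. exact: (lin_sum (right_linear_lin (n := n))). Qed.

Lemma right_linear_esum n I (r : seq I) (p : pred I) (F : I -> P n) :
  e (\sum_(i <- r | p i) F i) = \sum_(i <- r | p i) e (F i).
Proof. exact: (@lin_sum _ _ k^o _ (right_linear_elin (n := n))). Qed.

Lemma right_linear_hom n p (u : P n) : shom p u -> shom (p (+) s) (h u).
Proof. by move=> hu; have [] := mor_hom rh hu. Qed.

Lemma right_linear_ehom n p (u : P n) : shom p u -> p = s \/ e u = 0.
Proof. by move=> hu; have [] := mor_hom rh hu. Qed.

Lemma right_linear_comp (l m r : nat) (i : 'I_l) (a : r.+1 = (l + m)%N)
    (f : P l) (g : P m) :
  h (ocomp i a f g)
    = ocomp i a (h f) (j g) + e f *: transfer r (j g).
Proof. exact: (congr1 (fun w => w.1.2) (mor_comp rh i a f g)). Qed.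

Lemma right_linear_ecomp (l m r : nat) (i : 'I_l) (a : r.+1 = (l + m)%N)
    (f : P l) (g : P m) : e (ocomp i a f g) = 0.
Proof. exact: (congr1 snd (mor_comp rh i a f g)). Qed.

Lemma right_linear_act (hb : b) n (t : 'S_n) (f : P n) :
  h (oact hb t f) = oact hb t (h f).
Proof. exact: (congr1 (fun w => w.1.2) (mor_act rh hb t f)). Qed.

Lemma right_linear_eact (hb : b) n (t : 'S_n) (f : P n) :
  e (oact hb t f) = e f.
Proof. exact: (congr1 snd (mor_act rh hb t f)). Qed.

End Theory.

Lemma right_linear_intro P Q s (j h : forall n, P n -> Q n)
    (e : forall n, P n -> k) :
  morphism j ->
  (forall n (a : k) (u v : P n), h n (a *: u + v) = a *: h n u + h n v) ->
  (forall n (a : k) (u v : P n), e n (a *: u + v) = a * e n u + e n v) ->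
  (forall n p (u : P n), shom p u -> shom (p (+) s) (h n u)) ->
  (forall n p (u : P n), shom p u -> p = s \/ e n u = 0) ->
  (forall (l m r : nat) (i : 'I_l) (a : r.+1 = (l + m)%N) (f : P l) (g : P m),
    h r (ocomp i a f g)
      = ocomp i a (h l f) (j m g) + e l f *: transfer r (j m g)) ->
  (forall (l m r : nat) (i : 'I_l) (a : r.+1 = (l + m)%N) (f : P l) (g : P m),
    e r (ocomp i a f g) = 0) ->
  (forall (hb : b) n (t : 'S_n) (f : P n),
    h n (oact hb t f) = oact hb t (h n f)) ->
  (forall (hb : b) n (t : 'S_n) (f : P n), e n (oact hb t f) = e n f) ->
  right_linear s j h e.
Proof.
move=> [j1 j2 j3 j4] h1 e1 h2 e2 h3 e3 h4 e4; split.
- by move=> n a f g; congr (_, _, _); rewrite ?j1 ?h1 ?e1.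
- by move=> n p f hf; split; [exact: j2 | exact: h2 | exact: e2].
- by move=> l m r i a f g; congr (_, _, _); rewrite ?j3 ?h3 ?e3.
- by move=> hb n t f; congr (_, _, _); rewrite ?j4 ?h4 ?e4.
Qed.

Lemma right_linear0 P Q s (j : forall n, P n -> Q n) :
  morphism j -> right_linear s j (fun _ _ => 0) (fun _ _ => 0).
Proof.
move=> mj; apply: right_linear_intro => // *.
- by rewrite scaler0 addr0.
- by rewrite mulr0 addr0.
- exact: shom0.
- by right.
- by rewrite ocomp0l scale0r addr0.
- by rewrite oact0.
Qed.

(** The morphisms (j, h, e) and (j, 0, 0) agree on generators, hence everywhere. The coefficient [e]
    has to vanish on generators as well, since it feeds back into [h] on composites. *)
Lemma generated_right_linear0 P Q (g : forall n, P n) (x : P 0) s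
    (j h : forall n, P n -> Q n) (e : forall n, P n -> k) :
  generated_by g x -> morphism j -> right_linear s j h e ->
  (forall n, (0 < n)%N -> h n (g n) = 0 /\ e n (g n) = 0) ->
  h 0 x = 0 -> e 0 x = 0 -> forall n (f : P n), h n f = 0.
Proof.
move=> [og ex ug] mj rh hg hx hex n f.
have r0 := right_linear0 s mj.
have [_ u] := ug _ _ _ (morphism_odd_invariant r0 og) (mor_hom r0 ex).
suff /(u _ _ rh)/(_ r0) -/(_ (conj (fun _ _ => erefl) erefl) n f) [] : 
    (forall n, (0 < n)%N -> (j n (g n), h n (g n), e n (g n)) = (j n (g n), 0, 0))
    /\ (j 0 x, h 0 x, e 0 x) = (j 0 x, 0, 0) by [].
by split=> [n' n0|]; [have [-> ->] := hg n' n0 | rewrite hx hex].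
Qed.

(* h n f + e n f id is what is left of the tree f after removing its root,
   if that is a unary vertex, and 0 otherwise. *)
Definition root_removal P (g : forall n, P n) (x : P 0)
    (h : forall n, P n -> P n) (e : forall n, P n -> k) : Prop :=
  [/\ right_linear true (fun _ f => f) h e,
      forall n, (0 < n)%N -> h n (g n) = 0 /\ e n (g n) = (n == 1%N)%:R,
      h 0 x = 0 & e 0 x = 0].

Lemma root_removal_exists P (g : forall n, P n) (x : P 0) :
  generated_by g x -> exists h e, root_removal g x h e.
Proof.
move=> [og ex ug].
(* The coefficient is 1 exactly for m_1, whose root removal leaves the identity; both m_1 and the
   operator are odd, as [ext_hom] demands. *)
have oq : odd_invariant (P := ext_operad true P)
    (fun n => (g n, 0, (n == 1%N)%:R)).
  move=> n n0; have [o i] := og n n0; split.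
    by split; [| exact: shom0 | left].
  by move=> hb t; congr (_, _, _); [exact: i | exact: oact0].
have exy : shom false ((x, 0, 0) : ext_operad true P 0).
  by split; [| exact: shom0 | right].
have [[phi [mphi [phig phix]]] _] := ug _ _ _ oq exy.
have [_ u] := ug P g x og ex.
(* The first entry is an endomorphism that fixes the generators, hence the identity. *)
have phi1 n (f : P n) : (phi n f).1.1 = f.
  apply: (u (fun n f => (phi n f).1.1) (fun n f => f)) => //.
  - case: mphi => p1 p2 p3 p4; split.
    + by move=> n' a u1 u2; rewrite p1.
    + by move=> n' p u1 /p2[].
    + by move=> l m r i a u1 u2; rewrite p3.
    + by move=> hb n' t u1; rewrite p4.
  - by split=> [n' n0|]; rewrite ?phig ?phix.
exists (fun n f => (phi n f).1.2), (fun n f => (phi n f).2); split.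
- have mE n (f : P n) : phi n f = (f, (phi n f).1.2, (phi n f).2).
    by have := phi1 n f; case: (phi n f) => [[f' a] c] /= ->.
  exact: eq_morphism mphi mE.
- by move=> n n0; rewrite phig.
- by rewrite phix.
- by rewrite phix.
Qed.

(** * Root removal and the powers of the ideal (x) *)

Lemma filtration_ideal_pow P (I : forall n, P n -> Prop) :
  filtration (ideal_pow I).
Proof.
split.
- by move=> n f J fJ _; exact: filt0.
- by move=> c n J fJ _; exact: filt_zero.
- by move=> c n a f g hf hg J fJ IJ; apply: filt_lin => //; [exact: hf | exact: hg].
- move=> c c' l m r i a f g hf hg J fJ IJ.
  by apply: filt_comp => //; [exact: hf | exact: hg].
- by move=> hb c n t f hf J fJ IJ; apply: filt_act => //; exact: hf.
Qed.

Lemma ideal_ideal_gen P (x : P 0) : ideal (ideal_gen x).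
Proof.
split.
- by move=> n I hI _; exact: ideal0.
- by move=> n a f g hf hg I hI Ix; apply: ideal_lin => //; [exact: hf | exact: hg].
- by move=> l m r i e f g hf I hI Ix; apply: ideal_compl => //; exact: hf.
- by move=> l m r i e f g hg I hI Ix; apply: ideal_compr => //; exact: hg.
- by move=> hb n t f hf I hI Ix; apply: ideal_act => //; exact: hf.
Qed.

Lemma transfer_pred (V : nat -> superMod k) (I : forall n, V n -> Prop) m r
    (v : V m) : I r 0 -> I m v -> I r (transfer r v).
Proof.
move=> I0; have [<-|/eqP ne] := eqVneq m r; first by rewrite transfer_id.
by rewrite transfer_neq.
Qed.

(** The coefficient [e] vanishes on x and on all composites, hence on (x). So for f in (x) the extra
    term e f g of h (f o_i g) is absent, and for g in (x) it lies in (x). *)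
Lemma root_removal_ideal_gen P (g : forall n, P n) x h e n (f : P n) :
  root_removal g x h e -> ideal_gen x f -> ideal_gen x (h n f) /\ e n f = 0.
Proof.
move=> [rh hg hx ex] hf.
have [I0 Il Icl Icr Ia] := ideal_ideal_gen x.
suff [] : [/\ ideal_gen x f, ideal_gen x (h n f) & e n f = 0] by [].
apply: (hf (fun n f => [/\ ideal_gen x f, ideal_gen x (h n f) & e n f = 0])).
  split.
  - move=> n'; rewrite (lin0 (right_linear_lin rh (n := n'))).
    by split=> //; exact: (@lin0 _ _ k^o _ (right_linear_elin rh (n := n'))).
  - move=> n' a u v [u1 u2 u3] [v1 v2 v3]; split; first exact: Il.
      by rewrite (right_linear_lin rh); exact: Il.
    by rewrite (right_linear_elin rh) u3 v3 mulr0 addr0.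
  - move=> l m r i a u v [u1 u2 u3]; split; first exact: Icl.
      by rewrite (right_linear_comp rh) u3 scale0r addr0; exact: Icl.
    exact: (right_linear_ecomp rh).
  - move=> l m r i a u v [v1 v2 v3]; split; first exact: Icr.
      rewrite (right_linear_comp rh) addrC; apply: Il; last exact: Icr.
      exact: (transfer_pred (I := @ideal_gen k b P x)).
    exact: (right_linear_ecomp rh).
  - move=> hb n' t u [u1 u2 u3]; split; first exact: Ia.
      by rewrite (right_linear_act rh); exact: Ia.
    by rewrite (right_linear_eact rh).
by split=> //; rewrite hx.
Qed.

Lemma root_removal_ideal_pow P (g : forall n, P n) x h e c n (f : P n) :
  root_removal g x h e -> ideal_pow (ideal_gen x) c f ->
  ideal_pow (ideal_gen x) c (h n f) /\ ((0 < c)%N -> e n f = 0).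
Proof.
set I := ideal_gen x => rr hf; have [rh hg hx ex] := rr.
have [J0 Jz Jl Jc Ja] := filtration_ideal_pow I.
(* The vanishing of [e] for c > 0 has to be carried along: for u in step c1 and v in step c2, the
   term e u v is only known to lie in step c2, which is enough just for c1 = 0. *)
pose J c n (f : P n) :=
  [/\ ideal_pow I c f, ideal_pow I c (h n f) & ((0 < c)%N -> e n f = 0)].
suff [] : J c n f by [].
apply: hf; first split.
- by move=> n' u; split=> //; exact: J0.
- move=> c' n'; rewrite /J (lin0 (right_linear_lin rh (n := n'))).
  by split=> // _; exact: (@lin0 _ _ k^o _ (right_linear_elin rh (n := n'))).
- move=> c' n' a u v [u1 u2 u3] [v1 v2 v3]; split; first exact: Jl.
    by rewrite (right_linear_lin rh); exact: Jl.
  by move=> c0; rewrite (right_linear_elin rh) u3 // v3 // mulr0 addr0.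
- move=> c1 c2 l m r i a u v [u1 u2 u3] [v1 v2 v3]; split; first exact: Jc.
    rewrite (right_linear_comp rh) addrC; case: c1 u1 u2 u3 => [|c1] u1 u2 u3.
      by apply: Jl; [exact: (transfer_pred (I := @ideal_pow k b P I c2)) | exact: Jc].
    by rewrite u3 // scale0r add0r; exact: Jc.
  by move=> _; exact: (right_linear_ecomp rh).
- move=> hb c' n' t u [u1 u2 u3]; split; first exact: Ja.
    by rewrite (right_linear_act rh); exact: Ja.
  by rewrite (right_linear_eact rh).
move=> n' u Iu; have [Ih eu] := root_removal_ideal_gen rr Iu.
by split=> //; move=> F _ IF; exact: IF.
Qed.

End RightLinear.

(** * Passage to the completion *)

Section Completion.
Context {k : fieldType} {b : bool} {P C : operad k b}.
Context {J : nat -> forall n, P n -> Prop} (K : completion J C).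

Lemma cpi_linear c n (a : k) (f g : P n) :
  cpi K c (a *: f + g) = a *: cpi K c f + cpi K c g.
Proof. exact: (mor_lin (cpi_mor K c)). Qed.

Lemma cproj_linear c n (a : k) (z w : C n) :
  cproj K c (a *: z + w) = a *: cproj K c z + cproj K c w.
Proof. exact: (mor_lin (cproj_mor K c)). Qed.

Lemma cproj_le c c' n (z : C n) (f : P n) :
  (c <= c')%N -> cproj K c' z = cpi K c' f -> cproj K c z = cpi K c f.
Proof.
move=> /subnK <-; elim: (c' - c)%N => // d IH.
by rewrite addSn => E; apply: IH; rewrite -cproj_trans E ctrans_pi.
Qed.

(** Level 0 is left out because a coefficient that kills only [J 1] can be computed from
    representatives at positive levels only. *)
Lemma cproj_injS n (z z' : C n) :
  (forall c, cproj K c.+1 z = cproj K c.+1 z') -> z = z'.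
Proof.
move=> E; apply: (@cproj_inj _ _ _ _ _ K) => c.
by rewrite -cproj_trans E cproj_trans.
Qed.

Lemma cpi_lift c n (z : C n) : exists f : P n, cproj K c z = cpi K c f.
Proof. by have [f <-] := cpi_surj (cproj K c z); exists f. Qed.

(** The component of the wrong parity of any lift dies in the quotient, where its image is also a
    difference of two elements of the right parity. *)
Lemma cpi_lift_hom c n p (z : C n) :
  shom p z -> exists f : P n, shom p f /\ cproj K c z = cpi K c f.
Proof.
move=> hz; have [f E] := cpi_lift c z.
have [f0 [f1 [h0 h1 Ef]]] := shom_split f.
have piD : cpi K c f = cpi K c f0 + cpi K c f1.
  by rewrite Ef (linD (@cpi_linear c n)).
have hp := mor_hom (cproj_mor K c) hz.
case: p {hz} hp => hp.
  exists f1; split=> //; rewrite E piD.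
  rewrite [cpi K c f0](_ : _ = 0) ?add0r //; apply: shom_disj.
    exact: (mor_hom (cpi_mor K c) h0).
  have -> : cpi K c f0 = (-1) *: cpi K c f1 + cproj K c z.
    by rewrite E piD scaleN1r addrC addrK.
  by apply: shom_lin => //; exact: (mor_hom (cpi_mor K c) h1).
exists f0; split=> //; rewrite E piD.
rewrite [cpi K c f1](_ : _ = 0) ?addr0 //; apply: shom_disj.
  have -> : cpi K c f1 = (-1) *: cpi K c f0 + cproj K c z.
    by rewrite E piD scaleN1r addKr.
  by apply: shom_lin => //; exact: (mor_hom (cpi_mor K c) h0).
exact: (mor_hom (cpi_mor K c) h1).
Qed.

Lemma cproj_shom n p (z : C n) : (forall c, shom p (cproj K c z)) -> shom p z.
Proof.
move=> hz; have [v [w [hv hw E]]] := shom_split z.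
have pE c : cproj K c z = cproj K c v + cproj K c w.
  by rewrite E (linD (@cproj_linear c n)).
have hpv c : shom false (cproj K c v) := mor_hom (cproj_mor K c) hv.
have hpw c : shom true (cproj K c w) := mor_hom (cproj_mor K c) hw.
have p0 c : cproj K c (0 : C n) = 0 by rewrite (lin0 (@cproj_linear c n)).
case: p hz => hz; rewrite E.
  rewrite [v](_ : _ = 0) ?add0r //; apply: (@cproj_inj _ _ _ _ _ K) => c.
  rewrite p0; apply: shom_disj => //.
  have -> : cproj K c v = (-1) *: cproj K c w + cproj K c z.
    by rewrite pE scaleN1r addrC addrK.
  exact: shom_lin.
rewrite [w](_ : _ = 0) ?addr0 //; apply: (@cproj_inj _ _ _ _ _ K) => c.
rewrite p0; apply: shom_disj => //.
have -> : cproj K c w = (-1) *: cproj K c v + cproj K c z.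
  by rewrite pE scaleN1r addKr.
exact: shom_lin.
Qed.

(** A completion prescribes [ccan] only through its projections; their joint injectivity forces it
    to be a morphism. *)
Lemma morphism_ccan : morphism (ccan K).
Proof.
split=> [n a f g|n p f hf|l m r i e f g|hb n s f].
- apply: (@cproj_inj _ _ _ _ _ K) => c.
  by rewrite cproj_linear !ccan_proj cpi_linear.
- apply: cproj_shom => c; rewrite ccan_proj.
  exact: (mor_hom (cpi_mor K c) hf).
- apply: (@cproj_inj _ _ _ _ _ K) => c.
  by rewrite (mor_comp (cproj_mor K c)) !ccan_proj (mor_comp (cpi_mor K c)).
- apply: (@cproj_inj _ _ _ _ _ K) => c.
  by rewrite (mor_act (cproj_mor K c)) !ccan_proj (mor_act (cpi_mor K c)).
Qed.

(** Preserving every [J c], the map [h] descends to all quotients, and its values on representatives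
    chosen level by level are compatible. Allowing any representative in the conclusion reduces
    later identities to polynomials. *)
Lemma completion_lift (h : forall n, P n -> P n) :
  (forall n (a : k) (u v : P n), h n (a *: u + v) = a *: h n u + h n v) ->
  (forall c n (f : P n), J c f -> J c (h n f)) ->
  exists H : forall n, C n -> C n, forall c n (z : C n) (f : P n),
    cproj K c z = cpi K c f -> cproj K c (H n z) = cpi K c (h n f).
Proof.
move=> hlin hJ.
have wd c n (f f' : P n) :
    cpi K c f = cpi K c f' -> cpi K c (h n f) = cpi K c (h n f').
  move=> E; apply/eqP; rewrite -subr_eq0; apply/eqP.
  rewrite -(linB (@cpi_linear c n)) -(linB (@hlin n)).
  apply/(cpi_ker K); apply: hJ; apply/(cpi_ker K).
  by rewrite (linB (@cpi_linear c n)) E subrr.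
suff ex n (z : C n) : exists w : C n, forall c (f : P n),
    cproj K c z = cpi K c f -> cproj K c w = cpi K c (h n f).
  pose H n z := proj1_sig (constructive_indefinite_description _ (ex n z)).
  exists H => c n z f; rewrite /H.
  by case: constructive_indefinite_description => w /= Hw; exact: Hw.
pose rep c := proj1_sig (constructive_indefinite_description _ (cpi_lift c z)).
have repE c : cproj K c z = cpi K c (rep c).
  by rewrite /rep; case: constructive_indefinite_description.
have [|w Hw] := @cproj_lift _ _ _ _ _ K n (fun c => cpi K c (h n (rep c))).
  move=> c; rewrite ctrans_pi; apply: wd.
  by rewrite -repE -ctrans_pi -repE cproj_trans.
by exists w => c f E; rewrite Hw; apply: wd; rewrite -E -repE.
Qed.

Lemma completion_lift_scalar (e : forall n, P n -> k) :
  (forall n (a : k) (u v : P n), e n (a *: u + v) = a * e n u + e n v) ->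
  (forall n (f : P n), J 1 f -> e n f = 0) ->
  exists E : forall n, C n -> k, forall c n (z : C n) (f : P n),
    cproj K c.+1 z = cpi K c.+1 f -> E n z = e n f.
Proof.
move=> elin eJ.
pose rep n z := proj1_sig (constructive_indefinite_description _ (@cpi_lift 1 n z)).
have repE n z : cproj K 1 z = cpi K 1 (rep n z).
  by rewrite /rep; case: constructive_indefinite_description.
exists (fun n z => e n (rep n z)) => c n z f /(cproj_le (ltn0Sn c)) zf.
apply/eqP; rewrite -subr_eq0 -(@linB _ _ k^o _ (@elin n)); apply/eqP; apply: eJ.
by apply/(cpi_ker K); rewrite (linB (@cpi_linear 1 n)) -zf -repE subrr.
Qed.

Lemma completion_right_linear (h : forall n, P n -> P n)
    (e : forall n, P n -> k) (H : forall n, C n -> C n) (E : forall n, C n -> k) :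
  right_linear true (fun _ f => f) h e ->
  (forall c n (z : C n) (f : P n),
    cproj K c z = cpi K c f -> cproj K c (H n z) = cpi K c (h n f)) ->
  (forall c n (z : C n) (f : P n),
    cproj K c.+1 z = cpi K c.+1 f -> E n z = e n f) ->
  right_linear true (fun _ z => z) H E.
Proof.
move=> rh HE EE.
have linE c n (a : k) (z w : C n) f g : cproj K c z = cpi K c f ->
    cproj K c w = cpi K c g -> cproj K c (a *: z + w) = cpi K c (a *: f + g).
  by move=> Ez Ew; rewrite cproj_linear cpi_linear Ez Ew.
have compE c (l m r : nat) (i : 'I_l) (a : r.+1 = (l + m)%N) (z : C l) (w : C m)
    f g : cproj K c z = cpi K c f -> cproj K c w = cpi K c g ->
    cproj K c (ocomp i a z w) = cpi K c (ocomp i a f g).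
  move=> Ez Ew.
  by rewrite (mor_comp (cproj_mor K c)) (mor_comp (cpi_mor K c)) Ez Ew.
have actE c (hb : b) n (t : 'S_n) (z : C n) f : cproj K c z = cpi K c f ->
    cproj K c (oact hb t z) = cpi K c (oact hb t f).
  by move=> Ez; rewrite (mor_act (cproj_mor K c)) (mor_act (cpi_mor K c)) Ez.
apply: right_linear_intro; first exact: morphism_id.
- move=> n a u v; apply: cproj_injS => c.
  have [f Ef] := cpi_lift c.+1 u; have [g Eg] := cpi_lift c.+1 v.
  rewrite (HE _ _ _ _ (linE _ _ a _ _ _ _ Ef Eg)) cproj_linear.
  by rewrite (HE _ _ _ _ Ef) (HE _ _ _ _ Eg) (right_linear_lin rh) cpi_linear.
- move=> n a u v.
  have [f Ef] := cpi_lift 1 u; have [g Eg] := cpi_lift 1 v.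
  rewrite (EE _ _ _ _ (linE _ _ a _ _ _ _ Ef Eg)).
  by rewrite (EE _ _ _ _ Ef) (EE _ _ _ _ Eg) (right_linear_elin rh).
- move=> n p u hu; apply: cproj_shom => c.
  have [f [hf Ef]] := cpi_lift_hom c hu.
  rewrite (HE _ _ _ _ Ef); apply: (mor_hom (cpi_mor K c) _).
  exact: (right_linear_hom rh _).
- move=> n p u hu; have [f [hf Ef]] := cpi_lift_hom 1 hu.
  by rewrite (EE _ _ _ _ Ef); exact: (right_linear_ehom rh _).
- move=> l m r i a u v; apply: cproj_injS => c.
  have [f Ef] := cpi_lift c.+1 u; have [g Eg] := cpi_lift c.+1 v.
  rewrite (HE _ _ _ _ (compE _ _ _ _ _ a _ _ _ _ Ef Eg)) (right_linear_comp rh).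
  rewrite addrC cpi_linear [in RHS]addrC cproj_linear (EE _ _ _ _ Ef).
  congr (_ *: _ + _); last by rewrite (compE _ _ _ _ _ _ _ _ _ _ (HE _ _ _ _ Ef) Eg).
  rewrite (transfer_map (f := fun n z => cproj K c.+1 z)).
    rewrite (transfer_map (f := fun n f => cpi K c.+1 f)) ?Eg // => n.
    by rewrite (lin0 (@cpi_linear c.+1 n)).
  by move=> n; rewrite (lin0 (@cproj_linear c.+1 n)).
- move=> l m r i a u v.
  have [f Ef] := cpi_lift 1 u; have [g Eg] := cpi_lift 1 v.
  rewrite (EE _ _ _ _ (compE _ _ _ _ _ a _ _ _ _ Ef Eg)).
  exact: (right_linear_ecomp rh _ _ _ _).
- move=> hb n t u; apply: cproj_injS => c.
  have [f Ef] := cpi_lift c.+1 u.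
  rewrite (HE _ _ _ _ (actE _ _ _ t _ _ Ef)) (right_linear_act rh).
  by rewrite (actE _ _ _ t _ _ (HE _ _ _ _ Ef)).
- move=> hb n t u; have [f Ef] := cpi_lift 1 u.
  rewrite (EE _ _ _ _ (actE _ _ _ t _ _ Ef)) (EE _ _ _ _ Ef).
  exact: (right_linear_eact rh _ _ _).
Qed.

End Completion.

(** * The graded commutator of d with a right linear operator *)

Section Homotopy.
Context {k : fieldType} {b : bool}.

(* In the value at f o_i g, the terms e f *: d g from d h and from h d cancel:
   their signs differ since e vanishes on even elements. *)
Lemma right_linear_homotopy (C : dgOperad k b) (h : forall n, C n -> C n)
    (e : forall n, C n -> k) :
  right_linear true (fun _ z => z) h e ->
  right_linear false (fun _ z => z)
    (fun n z => diff (h n z) + h n (diff z) - z) (fun n z => e n (diff z)).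
Proof.
move=> rh.
have Dlin n (a : k) (u v : C n) :
    diff (h n (a *: u + v)) + h n (diff (a *: u + v)) - (a *: u + v)
    = a *: (diff (h n u) + h n (diff u) - u) + (diff (h n v) + h n (diff v) - v).
  rewrite (right_linear_lin rh) !diff_lin (right_linear_lin rh).
  rewrite scalerBr scalerDr opprD [RHS]addrACA; congr (_ + _); exact: addrACA.
have elin n (a : k) (u v : C n) :
    e n (diff (a *: u + v)) = a * e n (diff u) + e n (diff v).
  by rewrite diff_lin (right_linear_elin rh).
apply: right_linear_intro => //.
- move=> n p u hu; rewrite addbF -scaleN1r addrC; apply: shom_lin => //.
  apply: shomD; last first.
    by have := right_linear_hom rh (diff_odd hu); rewrite addbT negbK.
  by have := diff_odd (right_linear_hom rh hu); rewrite addbT negbK.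
- move=> n p u hu; case: (right_linear_ehom rh (diff_odd hu)) => [|->]; last by right.
  by case: p {hu} => //; left.
- move=> l m r i a f g.
  (* The Leibniz rule for d has a sign only for a homogeneous left factor; the general case follows
     by splitting f. *)
  suff homc p (u : C l) : shom p u ->
      diff (h r (ocomp i a u g)) + h r (diff (ocomp i a u g)) - ocomp i a u g
      = ocomp i a (diff (h l u) + h l (diff u) - u) g
        + e l (diff u) *: transfer r g.
    have [f0 [f1 [/homc E0 /homc E1 ->]]] := shom_split f.
    have := Dlin r 1 (ocomp i a f0 g) (ocomp i a f1 g).
    rewrite !scale1r -ocompDl => ->; rewrite E0 E1.
    have := Dlin l 1 f0 f1; rewrite !scale1r => ->.
    have := elin l 1 f0 f1; rewrite !scale1r mul1r => ->.
    by rewrite [in RHS]ocompDl [in RHS]scalerDl; exact: addrACA.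
  move=> hu.
  have hsign : e l u *: diff (transfer r g)
      = - ((-1) ^+ p *: (e l u *: transfer r (diff g))).
    rewrite (transfer_map (f := fun n z => diff z)); last first.
      by move=> n; rewrite (lin0 (@diff_lin _ _ C n)).
    case: (right_linear_ehom rh hu) => ->; last by rewrite !scale0r scaler0 oppr0.
    by rewrite expr1 scaleN1r opprK.
  rewrite (right_linear_comp rh) (linD (@diff_lin _ _ C r)) (linZ (@diff_lin _ _ C r)).
  rewrite hsign (diff_comp _ _ _ (right_linear_hom rh hu)) (diff_comp _ _ _ hu).
  rewrite (right_linearD rh) (right_linearZ rh).
  rewrite !(right_linear_comp rh) addbT signrN.
  rewrite scaleNr -[_ - _ *: _ - _]addrA -opprD -scalerDr [in LHS]addrACA addNr addr0.
  by rewrite ocompBl ocompDl addrA [LHS]addrAC.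
- move=> l m r i a f g.
  have [f0 [f1 [h0 h1 ->]]] := shom_split f.
  rewrite ocompDl (linD (@diff_lin _ _ C r)) (diff_comp _ _ _ h0) (diff_comp _ _ _ h1).
  rewrite !(right_linear_eD rh) !(right_linear_eZ rh) !(right_linear_ecomp rh).
  by rewrite !(mulr0, addr0).
- move=> hb n t f; rewrite (right_linear_act rh) !diff_act (right_linear_act rh).
  by rewrite (linB (oact_lin hb t)) (linD (oact_lin hb t)).
- by move=> hb n t f; rewrite diff_act (right_linear_eact rh).
Qed.
End Homotopy.

(** * Acyclicity of operads of power series *)

Section SeriesExtension.
Context {k : fieldType} {b : bool}.

Section RootRemoval.
Context {P : operad k b} {g : forall n, P n} {x : P 0}.
Context {h : forall n, P n -> P n} {e : forall n, P n -> k}.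
Hypothesis rr : root_removal g x h e.

(** Inserting x may pass through arity 1 without creating a removable root: [e] vanishes on every
    composite, whatever its arity. *)
Lemma root_removal_plug0 n (f : P n) :
  h f = 0 -> e f = 0 -> h (plug x f) = 0 /\ e (plug x f) = 0.
Proof.
have [rh _ _ _] := rr.
elim: n f => //= n IH f hf ef; apply: IH; last exact: (right_linear_ecomp rh).
by rewrite (right_linear_comp rh) hf ef scale0r addr0 ocomp0l.
Qed.

Lemma root_removal_plug n : (0 < n)%N ->
  h (plug x (g n)) = (n == 1%N)%:R *: x /\ e (plug x (g n)) = 0.
Proof.
have [rh hg _ _] := rr.
case: n => [//|[_|n n0]]; last first.
  by rewrite scale0r; have [hgn egn] := hg n.+2 n0; exact: root_removal_plug0.
have [h1 e1] := hg 1%N isT; split; last exact: (right_linear_ecomp rh).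
by rewrite /= (right_linear_comp rh) h1 e1 ocomp0l add0r transfer_id.
Qed.

Lemma root_removal_series (a : nat -> k) N : a 1%N = 1 ->
  h (\sum_(1 <= n < N.+2) a n *: plug x (g n)) = x /\
  e (\sum_(1 <= n < N.+2) a n *: plug x (g n)) = 0.
Proof.
have [rh _ _ _] := rr => a1.
rewrite (right_linear_sum rh) (right_linear_esum rh) !(big_ltn (isT : (1 < N.+2)%N)).
have [h1 e1] := root_removal_plug (ltn0Sn 0).
rewrite (right_linearZ rh) (right_linear_eZ rh) h1 e1 a1 !scale1r mulr0 add0r.
rewrite [X in x + X]big_nat_cond big1 ?addr0 => [|n]; last first.
  rewrite andbT => /andP[n1 _]; have [hn _] := root_removal_plug (ltnW n1).
  by rewrite (right_linearZ rh) hn gtn_eqF // scale0r scaler0.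
split=> //; rewrite big_nat_cond big1 // => n; rewrite andbT => /andP[n1 _].
have [_ en] := root_removal_plug (ltnW n1).
by rewrite (right_linear_eZ rh) en mulr0.
Qed.

Lemma root_removal_gen_comp n (c : 'I_n) (i : 'I_c.+1) :
  h (ocomp i (gen_arity c) (g c.+1) (g (n - c)%N)) = (c == 0%N :> nat)%:R *: g n.
Proof.
have [rh hg _ _] := rr; rewrite (right_linear_comp rh).
have [-> ->] := hg c.+1 isT; rewrite ocomp0l add0r eqSS.
case: eqP => [->|_]; last by rewrite !scale0r.
by rewrite subn0 transfer_id.
Qed.

End RootRemoval.

(** The coefficients [a] cover both 1/n! and 1; root removal sees only a 1 in d x. The last
    hypothesis isolates d m_n, whose form differs between the two operads. *)
Lemma series_ext_acyclic (O C : dgOperad k b) (m : forall n, O n)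
    (E : series_ext O C) (a : nat -> k) :
  freely_generated m -> a 1%N = 1 ->
  has_sum (se_compl E)
    (fun n => a n *: ccan (se_compl E) (plug (se_x E) (se_iota E (m n))))
    (diff (ccan (se_compl E) (se_x E))) ->
  (forall h e, root_removal (fun n => se_iota E (m n)) (se_x E) h e ->
    forall n, (0 < n)%N ->
      h n (se_iota E (diff (m n))) = se_iota E (m n) /\
      e n (se_iota E (diff (m n))) = 0) ->
  acyclic C.
Proof.
move=> fm a1; set K := se_compl E; set x := se_x E => sumx dm.
pose g n := se_iota E (m n).
have gen : generated_by g x := adjoin_generated_by fm (se_adjoin E).
have [h [e rr]] := root_removal_exists gen; have [rh hg hx ex] := rr.
have [|c n f hf|H HE] := completion_lift K (h := h).
- by move=> *; exact: (right_linear_lin rh).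
- by have [] := root_removal_ideal_pow rr hf.
have [|n f hf|e' EE] := completion_lift_scalar K (e := e).
- by move=> *; exact: (right_linear_elin rh).
- by have [_] := root_removal_ideal_pow rr hf; exact.
have rH := completion_right_linear rh HE EE.
have Hcan n (f : se_poly E n) : H n (ccan K f) = ccan K (h n f).
  apply: (@cproj_inj _ _ _ _ _ K) => c.
  by rewrite ccan_proj; apply: HE; rewrite ccan_proj.
have ecan n (f : se_poly E n) : e' n (ccan K f) = e n f.
  by apply: (EE 0%N); rewrite ccan_proj.
have can0 n : ccan K (0 : se_poly E n) = 0.
  exact: (lin0 (mor_lin (morphism_ccan K) (n := n))).
have d0 n : diff (0 : C n) = 0 by exact: (lin0 (@diff_lin _ _ C n)).
have rD := right_linear_homotopy rH.
set D := (fun n (z : C n) => diff (H n z) + H n (diff z) - z) in rD.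
have serE M : \sum_(1 <= n < M.+1) a n *: ccan K (plug x (g n))
    = ccan K (\sum_(1 <= n < M.+1) a n *: plug x (g n)).
  rewrite (lin_sum (mor_lin (morphism_ccan K) (n := 0))).
  apply: eq_bigr => n _.
  by rewrite (linZ (mor_lin (morphism_ccan K) (n := 0))).
(* At each level d x is a polynomial; the bound M + 2 ensures that the partial sum contains n =
   1. *)
have dxE c : exists M, cproj K c (diff (ccan K x))
    = cpi K c (\sum_(1 <= n < M.+2) a n *: plug x (g n)).
  by have [N HN] := sumx c; exists N; rewrite -(HN N.+1) ?leqnSn // serE ccan_proj.
have Dcan n (f : se_poly E n) : D n (ccan K f) = 0.
  apply: (generated_right_linear0 gen (morphism_ccan K)
            (morphism_comp (morphism_ccan K) rD)).
  - move=> p p0; have [h1 e1] := dm h e rr p p0.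
    rewrite /D !Hcan (hg p p0).1 can0 d0 se_diff Hcan ecan h1 e1.
    by rewrite add0r subrr.
  - rewrite /D Hcan hx can0 d0 add0r; apply/eqP; rewrite subr_eq0; apply/eqP.
    apply: (@cproj_inj _ _ _ _ _ K) => c; have [M HM] := dxE c.
    by rewrite (HE _ _ _ _ HM) (root_removal_series rr M a1).1 ccan_proj.
  - have [M HM] := dxE 1%N.
    by rewrite (EE _ _ _ _ HM) (root_removal_series rr M a1).2.
suff D0 n (z : C n) : D n z = 0.
  move=> n z dz; exists (H n z); apply/eqP; rewrite -subr_eq0; apply/eqP.
  rewrite -[RHS](D0 n z) /D dz (lin0 (right_linear_lin rH (n := n))) addr0 //.
apply: (@cproj_inj _ _ _ _ _ K) => c.
rewrite (lin0 (cproj_linear K c (n := n))).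
(* Subtracting a polynomial leaves w trivial at level c, which handles w itself, and at level c',
   which handles both d (H w) and H (d w) at level c. *)
have [c' Hc'] := se_cont E c n.
have [f Ef] := cpi_lift K (maxn c c') z.
pose w := z - ccan K f.
have -> : D n z = D n w.
  by rewrite /w (linB (right_linear_lin rD (n := n))) Dcan subr0.
have h0 : h n 0 = 0 := lin0 (right_linear_lin rh (n := n)).
have pi0 d : cpi K d (0 : se_poly E n) = 0 := lin0 (cpi_linear K d (n := n)).
have w0 : cproj K (maxn c c') w = cpi K (maxn c c') 0.
  by rewrite pi0 (linB (cproj_linear K _ (n := n))) Ef ccan_proj subrr.
have wc := cproj_le (leq_maxl c c') w0; have wc' := cproj_le (leq_maxr c c') w0.
have dw : cproj K c (diff w) = cpi K c 0 by rewrite pi0; apply: Hc'; rewrite wc' pi0.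
rewrite /D (linB (cproj_linear K c (n := n))).
rewrite (linD (cproj_linear K c (n := n))) wc (HE _ _ _ _ dw) h0 pi0.
rewrite Hc'; first by rewrite addr0 subr0.
by rewrite (HE _ _ _ _ wc') h0 pi0.
Qed.

End SeriesExtension.

(** * The terms of d m_n in the symmetric and the non-symmetric case *)

(** Such a permutation is increasing on all slots, so it moves none down, by induction from 0, and
    none up, by induction from the top. Thus m_1 o m_n occurs exactly once in d m_n. *)
Lemma shuffle_full n (s : 'S_n) : shuffle n s = (s == 1%g).
Proof.
apply/idP/eqP => [/forallP sh|->]; last first.
  apply/forallP=> i; apply/forallP=> j; apply/implyP=> /andP[ij _].
  by rewrite !perm1.
have mono (i j : 'I_n) : (i < j)%N -> (s i < s j)%N.
  move=> ij; have /forallP/(_ j)/implyP := sh i.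
  by apply; rewrite ij ltn_ord.
have le d (i : 'I_n) : i = d :> nat -> (i <= s i)%N.
  elim: d i => [|d IH] i id; first by rewrite id.
  have dn : (d < n)%N by apply: leq_trans (ltn_ord i); rewrite id.
  rewrite id; apply: leq_ltn_trans (mono (Ordinal dn) i _); last by rewrite id /=.
  exact: (IH (Ordinal dn)).
have ge d (i : 'I_n) : (n - i)%N = d -> (s i <= i)%N.
  elim: d i => [|d IH] i id.
    by move: (ltn_ord i); rewrite -subn_gt0 id.
  have [ni|ni] := leqP n i.+1.
    by rewrite -ltnS; exact: leq_trans (ltn_ord _) ni.
  rewrite -ltnS; apply: leq_trans (mono i (Ordinal ni) _) _ => //.
  by apply: (IH (Ordinal ni)); rewrite /= subnS id.
apply/permP=> i; apply: val_inj; apply/eqP.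
by rewrite perm1 eqn_leq (le i) // (ge (n - i)%N i).
Qed.

Theorem corollary6p11 (k : fieldType) (char0 : [pchar k] =i pred0) :
  (forall L : dgOperad k true, is_scrLinf L -> acyclic L) /\
  (forall A : dgOperad k false, is_scrAinf A -> acyclic A).
Proof.
split=> C [O [m [E [[fm dm] dx]]]].
- apply: (series_ext_acyclic fm _ dx) => [|h e rr n n0]; first by rewrite invr1.
  have [rh _ _ _] := rr; have [mi _ _] := se_adjoin E.
  have il := mor_lin mi (n := n).
  rewrite dm // (lin_sum il) (right_linear_sum rh) (right_linear_esum rh).
  split.
    rewrite (bigD1 (Ordinal n0)) //= [X in _ + X]big1 => [|c c0].
      rewrite addr0 (lin_sum il) (right_linear_sum rh).
      rewrite (eq_bigl (pred1 1%g)) => [|s]; last by rewrite /= subn0 shuffle_full.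
      rewrite big_pred1_eq oact1 (mor_comp mi).
      by rewrite (root_removal_gen_comp rr (c := Ordinal n0)) scale1r.
    rewrite (lin_sum il) (right_linear_sum rh) big1 // => s _.
    rewrite (mor_act mi) (mor_comp mi) (right_linear_act rh).
    rewrite (root_removal_gen_comp rr) [_ == _ :> nat](negPf c0) scale0r; exact: oact0.
  (* Every term of d m_n is a relabelled composite, so it has no identity coefficient. *)
  rewrite big1 // => c _.
  rewrite (lin_sum il) (right_linear_esum rh) big1 // => s _.
  by rewrite (mor_act mi) (mor_comp mi) (right_linear_eact rh) (right_linear_ecomp rh).
- apply: (series_ext_acyclic (E := E) (a := fun _ => 1) fm) => // [|h e rr n n0].
    move=> c; have [N HN] := dx c; exists N => M NM.
    by rewrite -(HN M NM); congr cproj; apply: eq_bigr => n _; rewrite scale1r.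
  have [rh _ _ _] := rr; have [mi _ _] := se_adjoin E.
  have il := mor_lin mi (n := n).
  rewrite dm // (lin_sum il) (right_linear_sum rh) (right_linear_esum rh).
  split.
    rewrite (bigD1 (Ordinal n0)) //= [X in _ + X]big1 => [|c c0].
      rewrite addr0 big_ord1 (mor_comp mi).
      by rewrite (root_removal_gen_comp rr (c := Ordinal n0)) scale1r.
    rewrite (lin_sum il) (right_linear_sum rh) big1 // => i _.
    by rewrite (mor_comp mi) (root_removal_gen_comp rr) [_ == _ :> nat](negPf c0) scale0r.
  rewrite big1 // => c _.
  rewrite (lin_sum il) (right_linear_esum rh) big1 // => i _.
  by rewrite (mor_comp mi) (right_linear_ecomp rh).
Qed.
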